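(* Let $A=\{x_1,x_2\}$ be an alphabet of two variables. For every positive integer $n$, $$\sum_{k=0}^{n}\phi_k(x_1+x_2)\,\phi_{n-k}(x_1+x_2)=(n+1)\phi_n(x_1+x_2)+2S_n(x_1+x_2),$$ $$\sum_{k=0}^{n}S_{k-1}(x_1+x_2)\,S_{n-k-1}(x_1+x_2)=\frac{1}{(x_1-x_2)^2}\left((n+1)\phi_n(x_1+x_2)-2S_n(x_1+x_2)\right),$$ $$\sum_{k=0}^{n}\phi_k(x_1+x_2)\,S_{n-k-1}(x_1+x_2)=(n+1)S_{n-1}(x_1+x_2).$$
   Context: Here $x_1,x_2$ are two commuting variables (indeterminates) and identities are in the field of rational functions in them. The notation $S_n(x_1+x_2)$, $\phi_n(x_1+x_2)$ denotes functions of the alphabet $\{x_1,x_2\}$ (not functions of the sum): $S_n(x_1+x_2)=\dfrac{x_1^{n+1}-x_2^{n+1}}{x_1-x_2}$ for $n\ge 0$, with $S_n(x_1+x_2)=0$ for $n<0$, and $\phi_n(x_1+x_2)=x_1^n+x_2^n$ for $n\ge 0$. *)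

(* Defs.v *)
From HB Require Import structures.
From mathcomp Require Import all_boot all_order all_algebra.
From mathcomp Require Import mpoly.

Set Implicit Arguments.
Unset Strict Implicit.
Unset Printing Implicit Defensive.

Import GRing.Theory.
Local Open Scope ring_scope.

Section SymmetricFunctions.
Variables (K : fieldType) (x1 x2 : K).

(* Indexed by int because the complete functions of negative degree, which do
   occur in the convolutions, vanish by convention. The quotient is the
   intended one only when x1 != x2. *)
Definition complete_sym (n : int) : K :=
  match n with
  | Posz m => (x1 ^+ m.+1 - x2 ^+ m.+1) / (x1 - x2)
  | Negz _ => 0
  end.

(* Note that [power_sum 0] is 2. *)
Definition power_sum (n : nat) : K := x1 ^+ n + x2 ^+ n.

End SymmetricFunctions.

Section RationalFunctions.
Variable F : fieldType.

Definition ratfun2 : fieldType := {fraction {mpoly F[2]}}.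

Definition var1 : ratfun2 := tofrac ('X_ord0 : {mpoly F[2]}).
Definition var2 : ratfun2 := tofrac ('X_ord_max : {mpoly F[2]}).

End RationalFunctions.

(* Main.v *)
(** Expanding each summand with [S_(k-1) = (x^k - y^k) / (x - y)], valid for all
    [k >= 0], leaves terms independent of [k] plus multiples of [x^k y^(n-k)]
    and [x^(n-k) y^k]. Each of these two families sums to [S_n] over
    [0 <= k <= n]; they reinforce each other in the first two identities and
    cancel in the third. *)
Require Import Defs.
From HB Require Import structures.
From mathcomp Require Import all_boot all_order all_algebra.
From mathcomp Require Import mpoly.
From mathcomp Require Import ring.

Set Implicit Arguments.
Unset Strict Implicit.
Unset Printing Implicit Defensive.

Import GRing.Theory.
Local Open Scope ring_scope.

Section TwoVariableConvolutions.
Variables (K : fieldType) (x y : K).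
Hypothesis xDy : x != y.

Let xBy_neq0 : x - y != 0.
Proof. by rewrite subr_eq0. Qed.

(** At [n = 0] the index is -1: the conventional value 0 agrees with the quotient because
    [x ^+ 0 - y ^+ 0] vanishes, so the end terms of the convolutions need no separate treatment. *)
Lemma complete_sym_pred (n : nat) :
  complete_sym x y (n%:Z - 1) = (x ^+ n - y ^+ n) / (x - y).
Proof.
case: n => [|n]; first by rewrite !expr0 subrr mul0r.
by rewrite -addn1 PoszD addrK addn1.
Qed.

(** Factor [x - y] out of [x ^+ n.+1 - y ^+ n.+1] and cancel it. *)
Lemma sum_mixed_powers (n : nat) :
  \sum_(0 <= k < n.+1) x ^+ (n - k) * y ^+ k = complete_sym x y n.
Proof. by rewrite /= subrXX mulrC mulKf // big_mkord. Qed.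

Lemma sum_mixed_powers_rev (n : nat) :
  \sum_(0 <= k < n.+1) x ^+ k * y ^+ (n - k) = complete_sym x y n.
Proof.
rewrite -sum_mixed_powers big_nat_rev /=.
apply: eq_big_nat => k /andP[_ /ltnSE kn].
by rewrite add0n subSS subKn.
Qed.

Lemma sum_power_sum_power_sum (n : nat) :
  \sum_(0 <= k < n.+1) power_sum x y k * power_sum x y (n - k)
    = n.+1%:R * power_sum x y n + 2%:R * complete_sym x y n.
Proof.
transitivity (\sum_(0 <= k < n.+1)
    (power_sum x y n + (x ^+ k * y ^+ (n - k) + x ^+ (n - k) * y ^+ k))).
  apply: eq_big_nat => k /andP[_ /ltnSE kn]; rewrite /power_sum.
  (* Splitting [n] as [k + (n - k)] makes the summand a polynomial identity in the [k]-th and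
     [(n - k)]-th powers. *)
  rewrite -[in x ^+ n](subnKC kn) -[in y ^+ n](subnKC kn) !exprD; ring.
rewrite big_split [X in _ + X = _]big_split /= sum_mixed_powers.
rewrite sum_mixed_powers_rev.
by rewrite -mulr2n sumr_const_nat subn0 !mulr_natl.
Qed.

Lemma sum_complete_sym_complete_sym (n : nat) :
  \sum_(0 <= k < n.+1)
      complete_sym x y (k%:Z - 1) * complete_sym x y (n%:Z - k%:Z - 1)
    = ((x - y) ^+ 2)^-1
      * (n.+1%:R * power_sum x y n - 2%:R * complete_sym x y n).
Proof.
transitivity (((x - y) ^+ 2)^-1 * \sum_(0 <= k < n.+1)
    (power_sum x y n - (x ^+ k * y ^+ (n - k) + x ^+ (n - k) * y ^+ k))).
  rewrite mulr_sumr; apply: eq_big_nat => k /andP[_ /ltnSE kn].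
  (* Since [k <= n], the integer difference is the cast of [n - k], which brings the second factor
     into the form of [complete_sym_pred]. *)
  rewrite subzn // !complete_sym_pred /power_sum.
  by rewrite -[in x ^+ n](subnKC kn) -[in y ^+ n](subnKC kn) !exprD; field.
rewrite sumrB [X in _ * (_ - X)]big_split /= sum_mixed_powers.
rewrite sum_mixed_powers_rev.
by rewrite -mulr2n sumr_const_nat subn0 !mulr_natl.
Qed.

Lemma sum_power_sum_complete_sym (n : nat) :
  \sum_(0 <= k < n.+1) power_sum x y k * complete_sym x y (n%:Z - k%:Z - 1)
    = n.+1%:R * complete_sym x y (n%:Z - 1).
Proof.
transitivity (\sum_(0 <= k < n.+1) (complete_sym x y (n%:Z - 1)
    + (x - y)^-1 * (x ^+ (n - k) * y ^+ k - x ^+ k * y ^+ (n - k)))).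
  apply: eq_big_nat => k /andP[_ /ltnSE kn].
  rewrite subzn // !complete_sym_pred /power_sum.
  by rewrite -[in x ^+ n](subnKC kn) -[in y ^+ n](subnKC kn) !exprD; field.
(* Both mixed families have the same sum, so the correction term vanishes. *)
rewrite big_split /= -mulr_sumr sumrB sum_mixed_powers.
by rewrite sum_mixed_powers_rev subrr mulr0 addr0 sumr_const_nat subn0 mulr_natl.
Qed.

End TwoVariableConvolutions.

(** As [tofrac] is injective, it suffices to compare coefficients at the monomial [U_(ord0)]: 1
    against 0. *)
Lemma var1_neq_var2 (F : fieldType) : var1 F != var2 F.
Proof.
rewrite tofrac_eq; apply/eqP => /(congr1 (mcoeff U_(ord0)%MM)) /eqP.
by rewrite !mcoeffXU eqxx oner_eq0.
Qed.

Theorem theorem2 (F : fieldType) (n : nat) (hn : (0 < n)%N) :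
  let x1 : ratfun2 F := var1 F in
  let x2 : ratfun2 F := var2 F in
  let S : int -> ratfun2 F := complete_sym x1 x2 in
  let phi : nat -> ratfun2 F := power_sum x1 x2 in
  [/\ \sum_(0 <= k < n.+1) phi k * phi (n - k)%N
        = (n.+1)%:R * phi n + 2%:R * S n%:Z,
      \sum_(0 <= k < n.+1) S (k%:Z - 1) * S (n%:Z - k%:Z - 1)
        = ((x1 - x2) ^+ 2)^-1 * ((n.+1)%:R * phi n - 2%:R * S n%:Z)
    & \sum_(0 <= k < n.+1) phi k * S (n%:Z - k%:Z - 1)
        = (n.+1)%:R * S (n%:Z - 1)].
Proof.
have x1Dx2 := var1_neq_var2 F.
split; first exact: sum_power_sum_power_sum.
  exact: sum_complete_sym_complete_sym.
exact: sum_power_sum_complete_sym.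
Qed.
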